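(* For every finite connected simplicial complex $S$ there exists a finitely presented $\mathbb Z$-system whose underlying topological space has a connected component homeomorphic to $S$.
   Context: A $\mathbb Z$-subshift is a closed shift-invariant subset of $\Sigma^{\mathbb Z}$, $\Sigma$ a finite alphabet; it is an SFT if it is defined by finitely many forbidden words. $(\Sigma^2)^{\mathbb Z}$ is identified with $\Sigma^{\mathbb Z}\times\Sigma^{\mathbb Z}$. A dynamical $\mathbb Z$-system (a homeomorphism of a compact metrizable space) is finitely presented (SFT/SFT) if it is conjugate (equivariantly homeomorphic) to $Y/Z$ for some SFTs $Y\subset\Sigma^{\mathbb Z}$, $Z\subset(\Sigma^2)^{\mathbb Z}$ such that $Z\cap Y^2$ is an equivalence relation on $Y$, where $Y/Z$ is the topological quotient $Y/(Z\cap Y^2)$ with the induced shift action. *)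

(* Defs.v *)
From HB Require Import structures.
From mathcomp Require Import all_boot all_order all_algebra.
From mathcomp Require Import generic_quotient.
From mathcomp Require Import all_classical all_reals.
From mathcomp Require Import topology.
Import Order.TTheory GRing.Theory Num.Theory.
Import numFieldTopology.Exports.

Set Implicit Arguments.
Unset Strict Implicit.
Unset Printing Implicit Defensive.

Local Open Scope classical_set_scope.
Local Open Scope ring_scope.
Local Open Scope quotient_scope.

Definition homeomorphism (X Y : topologicalType) (h : X -> Y) : Prop :=
  exists g : Y -> X, [/\ cancel h g, cancel g h, continuous h & continuous g].

Definition homeomorphic (X Y : topologicalType) : Prop :=
  exists h : X -> Y, homeomorphism h.

Definition metrizable (R : realType) (X : topologicalType) : Prop :=
  exists M : metricType R, homeomorphic X M.

(* A dynamical Z-system is presented by its generating homeomorphism. *)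
Record Zsystem (R : realType) := BuildZsystem {
  zspace :> topologicalType;
  zact : zspace -> zspace;
  zspace_compact : compact [set: zspace];
  zspace_metrizable : metrizable R zspace;
  zact_homeo : homeomorphism zact
}.

Definition conjugate (X Y : topologicalType) (f : X -> X) (g : Y -> Y) : Prop :=
  exists2 h : X -> Y, homeomorphism h & forall x, h (f x) = g (h x).

Notation config A := {ptws int -> discrete_topology A}.

Definition shift (A : finType) (x : config A) : config A :=
  fun i => x (i + 1).

Definition subshift (A : finType) (X : set (config A)) : Prop :=
  closed X /\ @shift A @` X = X.

Definition occurs_at (A : finType) (w : seq A) (x : config A) (i : int) : Prop :=
  [seq (x (i + k%:Z) : A) | k <- iota 0 (size w)] = w.

Definition avoiding (A : finType) (F : seq (seq A)) : set (config A) :=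
  [set x | forall w, w \in F -> forall i, ~ occurs_at w x i].

Definition SFT (A : finType) (X : set (config A)) : Prop :=
  subshift X /\ exists F : seq (seq A), X = avoiding F.

Lemma SFT_shift (A : finType) (X : set (config A)) (x : config A) :
  SFT X -> X x -> X (shift x).
Proof. by case=> -[_ E] _ Xx; rewrite -E; exists x. Qed.

(* Identifies A^Z * A^Z with (A * A)^Z. *)
Definition zip_config (A : finType) (x y : config A) : config (A * A)%type :=
  fun i => (x i, y i).

Definition equivalence_on (T : Type) (D : set T) (E : T -> T -> Prop) : Prop :=
  [/\ forall x, D x -> E x x,
      forall x y, D x -> D y -> E x y -> E y x
    & forall x y z, D x -> D y -> D z -> E x y -> E y z -> E x z].

(* pcover is Y and prel is Z in the quotient Y / (Z `&` Y^2). *)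
Record presentation (A : finType) := Presentation {
  pcover : set (config A);
  prel : set (config (A * A)%type);
  pcover_SFT : SFT pcover;
  prel_SFT : SFT prel;
  prel_equiv : equivalence_on pcover (fun x y => prel (zip_config x y))
}.

Section quotient_system.
Context (A : finType) (P : presentation A).

Definition pquot_rel : rel (set_type (pcover P)) :=
  fun x y => `[< prel P (zip_config (val x) (val y)) >].

Let pcoverP (x : set_type (pcover P)) : pcover P (val x).
Proof. exact/set_mem/(valP x). Qed.

Lemma pquot_rel_refl : reflexive pquot_rel.
Proof. by move=> x; apply/asboolP; case: (prel_equiv P) => + _ _; apply. Qed.

Lemma pquot_rel_sym : symmetric pquot_rel.
Proof.
case: (prel_equiv P) => _ S _ x y.
by apply/asboolP/asboolP; apply: S.
Qed.

Lemma pquot_rel_trans : transitive pquot_rel.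
Proof.
case: (prel_equiv P) => _ _ T y x z /asboolP xy /asboolP yz; apply/asboolP.
exact: T (pcoverP x) (pcoverP y) (pcoverP z) xy yz.
Qed.

Definition pquot_equiv : equiv_rel (set_type (pcover P)) :=
  EquivRel pquot_rel pquot_rel_refl pquot_rel_sym pquot_rel_trans.

Definition pquot : topologicalType := quotient_topology {eq_quot pquot_equiv}.

Definition pquot_pi (x : set_type (pcover P)) : pquot := \pi_{eq_quot pquot_equiv} x.

Lemma pcover_shift (x : set_type (pcover P)) : shift (val x) \in pcover P.
Proof. exact/mem_set/(SFT_shift (pcover_SFT P))/pcoverP. Qed.

Definition cover_shift (x : set_type (pcover P)) : set_type (pcover P) :=
  exist _ (shift (val x)) (pcover_shift x).

(* The choice of representative does not matter, see pquot_shift_pi. *)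
Definition pquot_shift (q : pquot) : pquot :=
  pquot_pi (cover_shift (repr (q : {eq_quot pquot_equiv}))).

Lemma pquot_piP x y : pquot_pi x = pquot_pi y <->
  prel P (zip_config (val x) (val y)).
Proof.
rewrite /pquot_pi; split; first by move/eqmodP/asboolP.
by move=> h; apply/eqmodP/asboolP.
Qed.

Lemma pquot_shift_pi x : pquot_shift (pquot_pi x) = pquot_pi (cover_shift x).
Proof.
apply/pquot_piP.
have /pquot_piP : pquot_pi (repr (pquot_pi x : {eq_quot pquot_equiv})) = pquot_pi x.
  exact: reprK.
exact: (SFT_shift (prel_SFT P)).
Qed.

End quotient_system.

Definition finitely_presented (R : realType) (X : Zsystem R) : Prop :=
  exists (A : finType) (P : presentation A),
    conjugate (@zact R X) (@pquot_shift A P).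

(* Abstract complexes; elements of V lying in no face are allowed and
   contribute nothing to the realization. *)
Record simplicial_complex (V : finType) := SimplicialComplex {
  faces : {set {set V}};
  face_neq0 : forall s, s \in faces -> s != finset.set0;
  face_sub : forall s t : {set V},
    s \in faces -> t \subset s -> t != finset.set0 -> t \in faces
}.

(* Geometric realization in barycentric coordinates. *)
Definition realization (R : realType) (V : finType) (S : simplicial_complex V) :
    set {ptws V -> R} :=
  [set x | [/\ forall v, 0 <= x v, \sum_v x v = 1
             & finset (fun v => x v != 0) \in faces S]].
Arguments realization R {V} S.

(* Main.v *)
Require Import Defs.
From HB Require Import structures.
From mathcomp Require Import all_boot all_order all_algebra.
From mathcomp Require Import generic_quotient.
From mathcomp Require Import all_classical all_reals topology normedtype sequences.
From mathcomp Require Import ring lra zify.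
Import Order.TTheory GRing.Theory Num.Theory.
Import numFieldTopology.Exports numFieldNormedType.Exports.

Set Implicit Arguments.
Unset Strict Implicit.
Unset Printing Implicit Defensive.

Local Open Scope classical_set_scope.
Local Open Scope ring_scope.
Local Open Scope quotient_scope.

(** The realization of [S] is homeomorphic, by dividing by the sum of the
    coordinates, to the space of the [t] in the cube $[0,1]^V$ with maximal
    coordinate 1 and support a face of [S].  Such a [t] is coded by the binary
    expansions of its coordinates, all read in parallel: a configuration is
    blank up to some position, and from there on it carries the digits of all
    the coordinates, together with a face [F] and a vertex [w] of [F], both
    constant along the configuration, such that the track of [w] has only
    digits 1 and the tracks outside [F] have only digits 0.  This is a local
    constraint, hence the cover is an SFT; it also contains configurations that
    are blank everywhere and configurations that are blank nowhere.

    Two configurations are glued when they have the same blanks and, on every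
    track, they differ at most by one carry, as ...0111... and ...1000... do.
    This condition involves windows of three letters only.  It amounts to
    asking that, at every position [i], the numbers in $[0,1]$ whose digits
    are read from [i] on coincide as points of the circle $[0,1]/(0 = 1)$
    ([carry_ok_circle_eq], [circle_eq_carry_ok]).  It is therefore an equality
    of countably many continuous real observables ([observeP]): gluing is an
    equivalence relation, and the quotient, which is compact, is metrizable
    ([separated_metrizable]); this makes it a system
    ([Zsystem_of_presentation]).

    The configurations whose first digits stand at position 0 form a clopen
    saturated set.  Reading its points one step earlier puts all the numbers
    in $[0,1/2]$, where the circle identification is trivial, so that the
    normalized coordinates induce a continuous bijection from this part of the
    quotient onto the realization ([position_inj], [position_surj]).  By
    compactness it is a homeomorphism, the part is connected because the
    realization is, and being clopen it is a connected component
    ([clopen_component_homeomorphic]). *)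

(** * Compact spaces and metrization *)

Lemma inv_expr2_lt (R : archiRealFieldType) (e : R) :
  0 < e -> exists N, (2 ^+ N)^-1 < e.
Proof.
move=> e0; exists (Num.bound e^-1).
by rewrite invf_plt ?posrE ?exprn_gt0//; exact: upper_nthrootP.
Qed.

Lemma continuous_compactT (X Y : topologicalType) (f : X -> Y) (A : set X) :
  continuous f -> compact A -> compact (f @` A).
Proof.
move=> cf cA; apply: continuous_compact => //.
exact: continuous_subspaceT.
Qed.

Lemma compact_bijection_homeomorphism (X Y : topologicalType) (f : X -> Y) :
  compact [set: X] -> hausdorff_space Y -> continuous f -> injective f ->
  (forall y, exists x, f x = y) -> homeomorphism f.
Proof.
move=> cX hY cf injf /choice[g fgK].
have gfK : cancel f g by move=> x; apply: injf; rewrite fgK.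
exists g; split => //.
apply/continuous_closedP => A cA.
have -> : g @^-1` A = f @` A.
  apply/seteqP; split=> [y Ay|_ [x Ax <-]]; last by rewrite /preimage /= gfK.
  by exists (g y).
apply: compact_closed => //; apply: continuous_compactT => //.
exact: subclosed_compact cX _.
Qed.

Lemma compact_set_type (X : topologicalType) (A : set X) :
  compact A -> compact [set: set_type A].
Proof.
move=> cA F PF _.
(* A cluster point of the image filter in the ambient space lies in [A]. *)
have [|p [Ap Gp]] := cA (set_val @ F) _.
  by apply: (@filterS _ F _ setT); [move=> x _; exact: set_valP|exact: filterT].
exists (SigSub (mem_set Ap)); split=> // B U FB [W [[O oO <-] /= Op] sU].
have [|_ [[x Bx <-] Ox]] := Gp (set_val @` B) O _ (open_nbhs_nbhs (conj oO Op)).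
  by apply: (@filterS _ F _ B) FB => x Bx; exists x.
by exists x; split => //; exact: sU.
Qed.

Lemma set_type_hausdorff (X : topologicalType) (A : set X) :
  hausdorff_space X -> hausdorff_space (set_type A).
Proof.
move=> hX p q pq; apply/val_inj/hX => U W nU nW.
have [r [Ur Wr]] := pq _ _ (@initial_continuous _ _ (@set_val _ A) p _ nU)
  (@initial_continuous _ _ (@set_val _ A) q _ nW).
by exists (set_val r).
Qed.

Lemma separated_hausdorff (R : realType) (X : topologicalType) (I : Type)
    (f : I -> X -> R) :
  (forall i, continuous (f i)) -> (forall x y, (forall i, f i x = f i y) -> x = y) ->
  hausdorff_space X.
Proof.
move=> cf sep p q pq; apply: sep => i; apply: (@Rhausdorff R) => U W nU nW.
by have [r [Ur Wr]] := pq _ _ (cf i p _ nU) (cf i q _ nW); exists (f i r).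
Qed.

Lemma continuous_set_type (X Y : topologicalType) (A : set Y) (f : X -> set_type A) :
  continuous (set_val \o f) -> continuous f.
Proof.
move=> cf x U [W [[O oO <-] /= Op] sU]; rewrite nbhs_filterE.
apply: filterS (preimage_subset sU) _; apply: (cf x O); exact: open_nbhs_nbhs.
Qed.

Lemma continuous_ptws (X Y : topologicalType) (I : Type) (f : X -> {ptws I -> Y}) :
  (forall i, continuous (fun x => f x i)) -> continuous f.
Proof.
move=> cf x; apply/cvg_sup => i.
move=> U [W [[O oO <-] /= Op] sU]; rewrite nbhs_filterE.
apply: filterS (preimage_subset sU) _; apply: (cf i x O); exact: open_nbhs_nbhs.
Qed.

Lemma ptws_eval (Y : topologicalType) (I : eqType) (i : I) :
  continuous (fun f : {ptws I -> Y} => f i).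
Proof. exact: (@proj_continuous I (fun=> Y) i). Qed.


(** A sequence of functions with values in $[0,1]$ that separates the points
    defines the metric $\sup_n |f_n(x) - f_n(y)| / 2^n$. *)
Section separation_metric.
Context (R : realType) (X : topologicalType) (f : nat -> X -> R).
Hypothesis f01 : forall n x, 0 <= f n x <= 1.
Hypothesis f_sep : forall x y, (forall n, f n x = f n y) -> x = y.

Let terms x y : set R := range (fun n => `|f n x - f n y| / 2 ^+ n).

Definition sepdist x y : R := sup (terms x y).

Let term_le1 x y n : `|f n x - f n y| <= 1.
Proof. by have := f01 n x; have := f01 n y; rewrite ler_norml; lra. Qed.

Lemma sepdist_ge x y n : `|f n x - f n y| / 2 ^+ n <= sepdist x y.
Proof.
apply: ub_le_sup; last by exists n.
exists 1 => _ [k _ <-]; rewrite ler_pdivrMr ?exprn_gt0// mul1r.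
by rewrite (le_trans (term_le1 x y k))// exprn_ege1// ler1n.
Qed.

Lemma sepdist_le x y e :
  (forall n, `|f n x - f n y| / 2 ^+ n <= e) -> sepdist x y <= e.
Proof.
move=> h; apply: ge_sup => [|_ [n _ <-] //].
by exists (`|f 0%N x - f 0%N y| / 2 ^+ 0), 0%N.
Qed.

Let sepdistxx x : sepdist x x = 0.
Proof.
apply/eqP; rewrite eq_le sepdist_le/=; last by move=> n; rewrite subrr normr0 mul0r.
by rewrite (le_trans _ (sepdist_ge x x 0))// subrr normr0 mul0r.
Qed.

Let sepdist_eq0 x y : sepdist x y = 0 -> x = y.
Proof.
move=> d0; apply: f_sep => n; apply/eqP; rewrite -subr_eq0 -normr_le0.
by have := sepdist_ge x y n; rewrite d0 ler_pdivrMr ?exprn_gt0// mul0r.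
Qed.

Let sepdist_sym x y : sepdist x y = sepdist y x.
Proof. by congr sup; apply: eq_imagel => n _; rewrite distrC. Qed.

Let sepdist_triangle y x z : sepdist x z <= sepdist x y + sepdist y z.
Proof.
apply: sepdist_le => n; rewrite (le_trans _ (lerD (sepdist_ge x y n) (sepdist_ge y z n)))//.
by rewrite -mulrDl ler_wpM2r ?invr_ge0 ?exprn_ge0// ler_distD.
Qed.

(** The set underlying [X], to be equipped with the metric [sepdist].  The two
    bindings record the hypotheses, on which the metric structure depends, so
    that it can be inferred from the type. *)
Definition sep_space : Type :=
  let _ := f_sep in let _ := f01 in (X : Type).

HB.instance Definition _ := Choice.on sep_space.
HB.instance Definition _ := @isMetric.Build R sep_space
  sepdist sepdistxx sepdist_eq0 sepdist_sym sepdist_triangle.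

Lemma sep_space_continuous :
  (forall n, continuous (f n)) -> continuous (id : X -> sep_space).
Proof.
move=> cf x; apply/metricType_numDomainType.cvgrPdist_le => e e0.
have [N /ltW Ne] := inv_expr2_lt e0.
have : \forall y \near x, forall k : 'I_N, `|f k x - f k y| < e.
  apply: filter_forall => k.
  by have /cvgrPdist_lt := cf k x; apply.
apply: filterS => y xy; apply: sepdist_le => n.
have [nN|Nn] := ltnP n N.
  rewrite ler_pdivrMr ?exprn_gt0// (le_trans (ltW (xy (Ordinal nN))))//.
  by rewrite ler_peMr ?(ltW e0)// exprn_ege1// ler1n.
apply: le_trans Ne; rewrite -[leRHS]mul1r ler_pM ?invr_ge0 ?exprn_ge0//.
by rewrite lef_pV2 ?posrE ?exprn_gt0// ler_eXn2l// ltr1n.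
Qed.

End separation_metric.

(** The identity from [X] to [X] with the metric is a continuous bijection from a
    compact space to a Hausdorff one. *)
Lemma separated_metrizable (R : realType) (X : topologicalType) (I : countType)
    (f : I -> X -> R) :
  compact [set: X] -> (forall i, continuous (f i)) ->
  (forall i x, 0 <= f i x <= 1) ->
  (forall x y, (forall i, f i x = f i y) -> x = y) -> metrizable R X.
Proof.
move=> cX cf f01 sep.
(* The family is made into a sequence by padding with zero functions. *)
pose g n x := if unpickle n is Some i then f i x else 0.
have g01 n x : 0 <= g n x <= 1.
  by rewrite /g; case: unpickle => [i|]; rewrite ?lexx ?ler01.
have gsep x y : (forall n, g n x = g n y) -> x = y.
  by move=> gxy; apply: sep => i; have := gxy (pickle i); rewrite /g pickleK.
have cg n : continuous (g n).
  by rewrite /g; case: unpickle => [i|] //; exact: cst_continuous.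
exists (sep_space g01 gsep), id.
apply: compact_bijection_homeomorphism => //.
- exact: metric_hausdorff.
- exact: sep_space_continuous.
- by move=> y; exists y.
Qed.

(** * Subshifts defined by a rule on three consecutive letters *)

Section local_rules.
Context (A : finType).
Implicit Types (ok : A -> A -> A -> bool) (x : config A).

Definition locally_ok ok : set (config A) :=
  [set x | forall i : int, ok (x i) (x (i + 1)) (x (i + 2%:Z))].

(** Configurations close to [x] have the same letter as [x] at position [i]. *)
Lemma near_letter x (i : int) : \forall y \near x, (y : config A) i = x i :> A.
Proof.
exact: (@ptws_eval (discrete_topology A) int i x _ (discrete_set1 _)).
Qed.

Lemma continuous_letter (Y : topologicalType) (i : int) (g : A -> Y) :
  continuous (fun x : config A => g (x i)).
Proof.
move=> x U nU; rewrite nbhs_filterE; apply: filterS (near_letter x i) => y yx.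
by rewrite /preimage /= yx; exact: nbhs_singleton nU.
Qed.

Lemma locally_ok_closed ok : closed (locally_ok ok).
Proof.
move=> x clx i; have [//|y [oky [yi yi1 yi2]]] := clx [set y : config A |
    [/\ y i = x i :> A, y (i + 1) = x (i + 1) :> A & y (i + 2%:Z) = x (i + 2%:Z) :> A]].
  by apply: filterS3 (near_letter x i) (near_letter x (i + 1)) (near_letter x (i + 2%:Z)) => y.
by rewrite -yi -yi1 -yi2; exact: oky.
Qed.

Lemma shift_locally_ok ok : @Defs.shift A @` locally_ok ok = locally_ok ok.
Proof.
apply/seteqP; split=> [_ [x okx <-] i|x okx].
  rewrite /Defs.shift; have := okx (i + 1).
  by rewrite -!addrA [1 + 2%:Z]addrC !addrA.
exists (fun i => x (i - 1)); last by apply/funext => i; rewrite /Defs.shift addrK.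
move=> i /=; have := okx (i - 1).
by rewrite addrAC [i - 1 + 2%:Z]addrAC.
Qed.

Lemma locally_ok_SFT ok : SFT (locally_ok ok).
Proof.
split; first by split; [exact: locally_ok_closed|exact: shift_locally_ok].
exists [seq [:: t.1.1; t.1.2; t.2] | t <- enum {: A * A * A} & ~~ ok t.1.1 t.1.2 t.2].
apply/seteqP; split=> x okx.
  move=> _ /mapP[[[a b] c] + ->] i; rewrite mem_filter /= => /andP[nok _] [].
  rewrite addr0 => xa xb xc; move: (okx i).
  by rewrite xa xb xc (negbTE nok).
move=> i; apply: contrapT => /negP nok.
apply: (okx [:: x i; x (i + 1); x (i + 2%:Z)] _ i).
  apply/mapP; exists (x i, x (i + 1), x (i + 2%:Z)) => //.
  by rewrite mem_filter nok mem_enum.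
by rewrite /occurs_at /= addr0.
Qed.

End local_rules.

(** * Binary expansions *)

Section binary_value.
Context (R : realType).
Implicit Types b : nat -> bool.

(** Partial sums of the number $0.b_0 b_1 b_2 \dots$ in base 2. *)
Definition bsum b (n : nat) : R := \sum_(k < n) (b k)%:R / 2 ^+ k.+1.

Lemma bsumS b n :
  bsum b n.+1 = ((b 0%N)%:R + bsum (fun k => b k.+1) n) / 2.
Proof.
rewrite /bsum big_ord_recl expr1 mulrDl; congr (_ + _).
rewrite mulr_suml; apply: eq_bigr => k _.
by rewrite lift0 [2 ^+ k.+2]exprSr invfM mulrA.
Qed.

Lemma bsum_bounds n b : 0 <= bsum b n <= 1.
Proof.
elim: n b => [|n IH] b; first by rewrite /bsum big_ord0 lexx ler01.
by rewrite bsumS; have := IH (fun k => b k.+1); case: (b 0%N) => /=; lra.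
Qed.

Lemma bsum_cvg b : cvgn (bsum b).
Proof.
apply: nondecreasing_is_cvgn.
  apply/nondecreasing_seqP => n; rewrite /bsum big_ord_recr /= lerDl.
  by rewrite divr_ge0 ?ler0n ?exprn_ge0.
by exists 1 => _ [n _ <-]; have /andP[] := bsum_bounds n b.
Qed.

Definition bval b : R := limn (bsum b).

Lemma bval_bounds b : 0 <= bval b <= 1.
Proof.
apply/andP; split; [apply: limr_ge|apply: limr_le]; try exact: bsum_cvg;
  by near=> n; have /andP[] := bsum_bounds n b.
Unshelve. all: by end_near. Qed.

(** This recursion and the bounds above are all that is used of [bval] from
    here on. *)
Lemma bvalS b : bval b = ((b 0%N)%:R + bval (fun k => b k.+1)) / 2.
Proof.
apply: cvg_lim => //; rewrite -cvg_shiftS /=.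
rewrite (_ : (fun n => _) = fun n => ((b 0%N)%:R + bsum (fun k => b k.+1) n) / 2); last first.
  by apply/funext => n; rewrite bsumS.
apply: cvgMl; apply: cvgD; first exact: cvg_cst.
exact: bsum_cvg.
Qed.

Lemma bval_close n b c :
  (forall k, (k < n)%N -> b k = c k) -> `|bval b - bval c| <= (2 ^+ n)^-1.
Proof.
elim: n b c => [|n IH] b c bc.
  have := bval_bounds b; have := bval_bounds c.
  by rewrite expr0 invr1 ler_norml; lra.
have := IH (fun k => b k.+1) (fun k => c k.+1) (fun k kn => bc k.+1 kn).
rewrite [bval b]bvalS [bval c]bvalS bc// exprS invfM !ler_norml.
move: (bval _) (bval _) (_ ^-1) => u v w; lra.
Qed.

Lemma eq_bval b c : b =1 c -> bval b = bval c.
Proof. by move/funext ->. Qed.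

Lemma bval_eq1 b : bval b = 1 <-> forall k, b k.
Proof.
split=> [b1 k|b1].
  elim: k b b1 => [|k IH] b b1.
    have := bvalS b; have := bval_bounds (fun k => b k.+1).
    by rewrite b1; case: (b 0%N) => //=; lra.
  apply: (IH (fun k => b k.+1)).
  have := bvalS b; have := bval_bounds (fun k => b k.+1).
  by rewrite b1; case: (b 0%N) => /=; lra.
have := bvalS b; rewrite (_ : (fun k => _) = b) ?b1/=; first lra.
by apply/funext => k; rewrite !b1.
Qed.

Lemma bval_eq0 b : bval b = 0 <-> forall k, ~~ b k.
Proof.
split=> [b1 k|b1].
  elim: k b b1 => [|k IH] b b1.
    have := bvalS b; have := bval_bounds (fun k => b k.+1).
    by rewrite b1; case: (b 0%N) => //=; lra.
  apply: (IH (fun k => b k.+1)).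
  have := bvalS b; have := bval_bounds (fun k => b k.+1).
  by rewrite b1; case: (b 0%N) => /=; lra.
have := bvalS b; rewrite (_ : (fun k => _) = b) ?(negbTE (b1 _))/=; first lra.
by apply/funext => k; rewrite !(negbTE (b1 _)).
Qed.

Lemma bval_surj (t : R) : 0 <= t <= 1 -> exists b, bval b = t.
Proof.
(* Greedy expansion: [rem n] is the remainder, rescaled to the unit interval,
   after [n] digits. *)
pose next (u : R) := if 2^-1 <= u then 2 * u - 1 else 2 * u.
pose rem := fun n => iter n next t.
move=> t01; pose b n := 2^-1 <= rem n.
have rem01 n : 0 <= rem n <= 1.
  elim: n => //= n; rewrite /next; case: ifPn; rewrite -?ltNge; lra.
have remS n : rem n = ((b n)%:R + rem n.+1) / 2.
  by rewrite /b /= /next; case: ifPn => _ /=; lra.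
have close m : forall n, `|bval (fun k => b (n + k)%N) - rem n| <= (2 ^+ m)^-1.
  elim: m => [|m IH] n.
    have := bval_bounds (fun k => b (n + k)%N); have := rem01 n.
    by rewrite expr0 invr1 ler_norml; lra.
  rewrite bvalS remS addn0.
  have -> : (fun k => b (n + k.+1)%N) = (fun k => b (n.+1 + k)%N).
    by apply/funext => k; rewrite addSnnS.
  have := IH n.+1; rewrite exprS invfM !ler_norml.
  move: (bval _) (rem _) (_ ^-1) => u v w; lra.
exists b; apply/eqP; rewrite -subr_eq0 -normr_le0 leNgt; apply/negP.
move=> /inv_expr2_lt[m]; rewrite ltNge => /negP; apply.
exact: close m 0%N.
Qed.

End binary_value.

(** * Coordinates on the circle *)

Section circle.
Context (R : realType).
Implicit Types u v : R.

(** [u] and [v] differ by -1, 0 or 1: for numbers in $[0,1]$ this is equality in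
    the circle $[0,1]/(0 = 1)$. *)
Definition circle_eq u v : Prop := [\/ u = v, u = v + 1 | v = u + 1].

(** The distance from [u] in $[0,1]$ to the set {0, 1}. *)
Definition tent u : R := (1 - `|2 * u - 1|) / 2.

(** A second function on the circle: it tells apart [u] and [1 - u], which have
    the same [tent], unless [tent] vanishes. *)
Definition skew u : R := (1 + tent u * (1 - 2 * u)) / 2.

Lemma tent_bounds u : 0 <= u <= 1 -> 0 <= tent u <= 2^-1.
Proof. by rewrite /tent; case: (ger0P (2 * u - 1)); lra. Qed.

Lemma skew_bounds u : 0 <= u <= 1 -> 0 <= skew u <= 1.
Proof. by move=> u01; have := tent_bounds u01; rewrite /skew => /andP[? ?]; nra. Qed.

Lemma tent_half u : u <= 2^-1 -> tent u = u.
Proof. by rewrite /tent; case: (ger0P (2 * u - 1)); lra. Qed.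

(** [tent] and [skew] together embed the circle. *)
Lemma circle_eqP u v : 0 <= u <= 1 -> 0 <= v <= 1 ->
  circle_eq u v <-> tent u = tent v /\ skew u = skew v.
Proof.
move=> u01 v01.
have t0 : tent 0 = 0 by rewrite /tent mulr0 sub0r normrN1 subrr mul0r.
have t1 : tent 1 = 0.
  by rewrite /tent (_ : 2 * 1 - 1 = 1 :> R) ?normr1 ?subrr ?mul0r//; lra.
split.
  case=> [->//|uv|uv].
    have -> : u = 1 by lra.
    have -> : v = 0 by lra.
    by rewrite /skew t0 t1 !mul0r.
  have -> : u = 0 by lra.
  have -> : v = 1 by lra.
  by rewrite /skew t0 t1 !mul0r.
rewrite /skew => -[tuv]; rewrite tuv => suv.
have [tv0|tv0] := eqVneq (tent v) 0.
  have h w : 0 <= w <= 1 -> tent w = 0 -> w = 0 \/ w = 1.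
    by rewrite /tent; case: (ger0P (2 * w - 1)) => ? ? ?; [right|left]; lra.
  case: (h _ u01 (etrans tuv tv0)) => ->; case: (h _ v01 tv0) => ->;
    by [constructor 1|constructor 2; lra|constructor 3; lra].
constructor 1; have : tent v * (1 - 2 * u) = tent v * (1 - 2 * v) by lra.
by move/(mulfI tv0); lra.
Qed.

Lemma circle_eq_double (a b : bool) u v : 0 <= u <= 1 -> 0 <= v <= 1 ->
  circle_eq ((a%:R + u) / 2) ((b%:R + v) / 2) -> circle_eq u v.
Proof.
move=> u01 v01; case: a b => -[] /= []; intros;
  by [constructor 1; lra|constructor 2; lra|constructor 3; lra].
Qed.

Lemma continuous_tent : continuous tent.
Proof.
move=> u; apply: cvgMl; apply: cvgB; first exact: cvg_cst.
apply: cvg_norm; apply: cvgB; last exact: cvg_cst.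
by apply: cvgMr; exact: cvg_id.
Qed.

Lemma continuous_skew : continuous skew.
Proof.
move=> u; apply: cvgMl; apply: cvgD; first exact: cvg_cst.
apply: cvgM; first exact: continuous_tent.
apply: cvgB; first exact: cvg_cst.
by apply: cvgMr; exact: cvg_id.
Qed.

End circle.

(** * Carries in bi-infinite binary sequences *)

Section tracks.
Context (R : realType).
Implicit Types x y : int -> bool.

(** The number whose binary digits are read on [x] from position [i] on. *)
Definition tval x (i : int) : R := bval R (fun k => x (i + k%:Z)).

Lemma tval_bounds x i : 0 <= tval x i <= 1.
Proof. exact: bval_bounds. Qed.

Lemma tvalS x i : tval x i = ((x i)%:R + tval x (i + 1)) / 2.
Proof.
rewrite {1}/tval bvalS addr0; congr ((_ + _) / 2).
by apply: eq_bval => k; rewrite -addrA.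
Qed.

(** The local rule for pairs of sequences, on a window of three positions.  With
    $d_i = x_i - y_i$, it says that a nonzero $d_i$ is followed by a nonzero
    $d_{i+1}$; that the first nonzero difference is followed by its opposite;
    and that after two nonzero differences the second one is repeated.  So
    $(d_i)$ is constant, or of the form $\dots 0\,0\,s\,(-s)\,(-s)\dots$ with
    $s = \pm 1$. *)
Definition carry_ok (x0 x1 x2 y0 y1 y2 : bool) : bool :=
  if x1 == y1 then x0 == y0
  else if x0 == y0 then (x2 == ~~ x1) && (y2 == ~~ y1)
  else (x2 == x1) && (y2 == y1).

Lemma circle_eq_int (u v : R) : circle_eq u v ->
  exists D : int, u - v = D%:~R /\ (`|D| <= 1)%N.
Proof.
by case=> h; [exists 0|exists 1|exists (-1)]; split=> //; rewrite ?mulrNz; lra.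
Qed.

(** The differences $D_i$ of the values are integers of absolute value at most 1
    with $2 D_i = d_i + D_{i+1}$; the rule follows by inspection of all cases. *)
Lemma circle_eq_carry_ok x y i :
  (forall j, circle_eq (tval x j) (tval y j)) ->
  carry_ok (x i) (x (i + 1)) (x (i + 2%:Z)) (y i) (y (i + 1)) (y (i + 2%:Z)).
Proof.
move=> xy.
have step j D E : tval x j - tval y j = D%:~R ->
    tval x (j + 1) - tval y (j + 1) = E%:~R -> (x j)%:Z - (y j)%:Z + E = D *+ 2.
  move=> hD hE; apply: (@intr_inj R); rewrite rmorphD rmorphB rmorphMn /= -hD -hE.
  rewrite (tvalS x j) (tvalS y j); set u := tval x _; set v := tval y _.
  by rewrite -!pmulrn mulr2n; lra.
have [D0 [h0 b0]] := circle_eq_int (xy i).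
have [D1 [h1 b1]] := circle_eq_int (xy (i + 1)).
have [D2 [h2 b2]] := circle_eq_int (xy (i + 1 + 1)).
have [D3 [h3 b3]] := circle_eq_int (xy (i + 1 + 1 + 1)).
have := step _ _ _ h0 h1; have := step _ _ _ h1 h2; have := step _ _ _ h2 h3.
rewrite (_ : i + 2%:Z = i + 1 + 1) -?addrA // !mulr2n.
rewrite /carry_ok.
move: b0 b1 b2 b3; clear.
by case: (x i); case: (y i); case: (x _); case: (y _); case: (x _); case: (y _) => //=; lia.
Qed.

Section carry.
Variables x y : int -> bool.
Hypothesis xy : forall i,
  carry_ok (x i) (x (i + 1)) (x (i + 2%:Z)) (y i) (y (i + 1)) (y (i + 2%:Z)).

(** Two consecutive differences propagate to the right forever. *)
Lemma carry_const j k : x j != y j -> x (j + 1) != y (j + 1) ->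
  x (j + 1 + k%:Z) = x (j + 1) /\ y (j + 1 + k%:Z) = y (j + 1).
Proof.
elim: k j => [|k IH] j xj xj1; first by rewrite addr0.
have := xy j; rewrite /carry_ok (negbTE xj) (negbTE xj1).
rewrite (_ : j + 2%:Z = j + 1 + 1) -?addrA // addrA => /andP[/eqP x2 /eqP y2].
have [] := IH (j + 1) xj1; first by rewrite x2 y2.
by rewrite x2 y2 intS -!addrA.
Qed.

Lemma carry_tval j : x j != y j -> x (j + 1) != y (j + 1) ->
  tval x (j + 1) = (x (j + 1))%:R /\ tval y (j + 1) = (y (j + 1))%:R.
Proof.
move=> xj xj1.
have h (z : int -> bool) : (forall k : nat, z (j + 1 + k%:Z) = z (j + 1)) ->
    tval z (j + 1) = (z (j + 1))%:R.
  case: (z (j + 1)) => zk; first by apply/bval_eq1 => k; rewrite zk.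
  by apply/bval_eq0 => k; rewrite zk.
by split; apply: h => k; have [] := carry_const k xj xj1.
Qed.

(** At the first difference the two tails are 0111... and 1000... *)
Lemma carry_start j : x j = y j -> x (j + 1) != y (j + 1) ->
  tval x (j + 1) = tval y (j + 1).
Proof.
move=> xj xj1; have := xy j; rewrite /carry_ok (negbTE xj1) xj eqxx.
rewrite (_ : j + 2%:Z = j + 1 + 1) -?addrA // addrA => /andP[/eqP x2 /eqP y2].
have [] := carry_tval xj1; first by move: xj1; rewrite x2 y2; do 2!case: (_ (j + 1)).
rewrite (tvalS x (j + 1)) (tvalS y (j + 1)) => -> ->; rewrite x2 y2.
by move: xj1; do 2!case: (_ (j + 1)) => //=; lra.
Qed.

(** Either a first difference occurs further right, or the digits agree forever;
    instead of deciding between the two, the gap is bounded by $2^{-m}$ for all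
    [m]. *)
Lemma carry_agree j : x j = y j -> tval x j = tval y j.
Proof.
move=> xj; apply/eqP; rewrite -subr_eq0 -normr_le0 leNgt; apply/negP.
move=> /inv_expr2_lt[m]; rewrite ltNge => /negP; apply.
elim: m j xj => [|m IH] j xj.
  have := tval_bounds x j; have := tval_bounds y j.
  by rewrite expr0 invr1 ler_norml; lra.
rewrite (tvalS x j) (tvalS y j) xj exprS invfM.
have [/IH|/(carry_start xj) ->] := eqVneq (x (j + 1)) (y (j + 1)).
  by rewrite !ler_norml; move: (tval _ _) (tval _ _) (_ ^-1) => u v w; lra.
by rewrite subrr normr0 mulr_ge0 ?invr_ge0 ?exprn_ge0.
Qed.

Lemma carry_ok_circle_eq i : circle_eq (tval x i) (tval y i).
Proof.
have [/carry_agree ->|] := eqVneq (x i) (y i); first by constructor 1.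
rewrite -[i](subrK 1); set j := i - 1 => xj1.
have [xj|xj] := eqVneq (x j) (y j); first by constructor 1; exact: carry_start.
have [-> ->] := carry_tval xj xj1.
move: xj1; case: (x (j + 1)); case: (y (j + 1)) => //= _; [constructor 2|constructor 3]; lra.
Qed.

End carry.
End tracks.

(** * Connected components *)

(** Under a continuous map from a compact space to a Hausdorff one that is
    injective on the closed set [C], a separation of [C] is sent to a separation
    of the image. *)
Lemma connected_preimage_injective (X Y : topologicalType) (f : X -> Y) (C : set X) :
  compact [set: X] -> hausdorff_space Y -> continuous f -> closed C ->
  {in C &, injective f} -> connected (f @` C) -> connected C.
Proof.
move=> cX hY cf clC injf cfC B [b Bb] [O oO BO] [K cK BK].
have BC : B `<=` C by rewrite BO => x [].
have fclosed E : closed E -> closed (f @` E).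
  move=> cE; apply: compact_closed => //; apply: continuous_compactT => //.
  exact: subclosed_compact cX _.
have cB : closed (f @` B) by apply: fclosed; rewrite BK; exact: closedI.
have cCB : closed (f @` (C `&` ~` O)).
  by apply: fclosed; apply: closedI => //; exact: open_closedC.
have fBC : f @` B = f @` C.
  apply: cfC; first by exists (f b), b.
    exists (~` (f @` (C `&` ~` O))); first exact: closed_openC.
    apply/seteqP; split=> [_ [x Bx <-]|_ [[x Cx <-] nO]].
      split; first by exists x => //; exact: BC.
      move=> [y [Cy nOy] fyx]; apply: nOy; move: Bx; rewrite BO => -[Cx Ox].
      by rewrite (injf _ _ _ _ fyx) ?inE.
    exists x => //; rewrite BO; split=> //; apply: contrapT => nOx.
    by apply: nO; exists x.
  exists (f @` B) => //; rewrite setIC setIidl//.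
  by move=> _ [x Bx <-]; exists x => //; exact: BC.
apply/seteqP; split=> // x Cx.
have [y By fyx] : (f @` B) (f x) by rewrite fBC; exists x.
by rewrite -(injf _ _ _ _ fyx) ?inE//; exact: BC.
Qed.

Lemma connected_component_clopen (X : topologicalType) (C : set X) (x : X) :
  clopen C -> connected C -> C x -> connected_component [set: X] x = C.
Proof.
move=> [oC clC] cC Cx; apply/seteqP; split; last exact: connected_component_max.
have /(_ (connected_component setT x `&` C)) := @component_connected X setT x.
move=> /(_ _ _ _)/setIidPl; apply.
- by exists x; split => //; exact: connected_component_refl.
- by exists C.
- by exists C.
Qed.

Lemma clopen_component_homeomorphic (X Y : topologicalType) (f : X -> Y)
    (C : set X) (D : set Y) (x : X) :
  compact [set: X] -> hausdorff_space Y -> continuous f -> clopen C ->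
  {in C &, injective f} -> f @` C = D -> connected D -> C x ->
  homeomorphic (set_type (connected_component [set: X] x)) (set_type D).
Proof.
move=> cX hY cf coC injf fCD cD Cx.
have cC : connected C.
  by apply: (connected_preimage_injective cX hY cf) => //; [exact: coC.2|rewrite fCD].
rewrite (connected_component_clopen coC cC Cx).
have fD (z : C) : f (set_val z) \in D.
  by apply/mem_set; rewrite -fCD; exists (set_val z) => //; exact: set_valP.
exists (fun z => SigSub (fD z)); apply: compact_bijection_homeomorphism.
- by apply: compact_set_type; apply: subclosed_compact cX _ => //; exact: coC.2.
- exact: set_type_hausdorff.
- apply: continuous_set_type => z.
  apply: (@continuous_comp _ _ _ (@set_val _ C) f); last exact: cf.
  exact: initial_continuous.
- move=> y z /(congr1 set_val) /= fyz; apply: val_inj; apply: injf => //;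
  exact: valP.
- move=> y; have [z Cz fzy] : (f @` C) (set_val y) by rewrite fCD; exact: set_valP.
  by exists (SigSub (mem_set Cz)); exact: val_inj.
Qed.

(** * The quotient of a presentation *)

Lemma config_compact (A : finType) : compact [set: config A].
Proof.
have -> : [set: config A] = [set x : config A | forall i, setT (x i)].
  by apply/seteqP; split.
apply: (@tychonoff int (fun=> discrete_topology A) (fun=> setT)) => _.
apply: finite_compact; exact: (@finite_finset A setT).
Qed.

Lemma continuous_shift (A : finType) : continuous (@Defs.shift A).
Proof. by apply: continuous_ptws => i; exact: ptws_eval. Qed.

Section quotient.
Context (A : finType) (P : presentation A).

Lemma pcover_compact : compact [set: set_type (pcover P)].
Proof.
apply: compact_set_type; apply: subclosed_compact (@config_compact A) _ => //.
by have [[]] := pcover_SFT P.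
Qed.

Definition pquot_repr (q : pquot P) : set_type (pcover P) :=
  repr (q : {eq_quot pquot_equiv P}).

Lemma pquot_repr_pi (q : pquot P) : pquot_pi (pquot_repr q) = q.
Proof. exact: reprK. Qed.

Lemma continuous_pquot_pi : continuous (@pquot_pi A P).
Proof. exact: (@pi_continuous _ {eq_quot pquot_equiv P}). Qed.

Lemma pquot_compact : compact [set: pquot P].
Proof.
have -> : [set: pquot P] = @pquot_pi A P @` setT.
  by apply/seteqP; split=> // q _; exists (pquot_repr q) => //; exact: pquot_repr_pi.
exact: continuous_compactT continuous_pquot_pi pcover_compact.
Qed.

(** The map induced on the quotient by a map [g] on the cover; it is meaningful
    when [g] is constant on the classes. *)
Definition pquot_lift (T : Type) (g : set_type (pcover P) -> T) (q : pquot P) : T :=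
  g (pquot_repr q).

(** [g] is constant on the classes of the quotient. *)
Definition respects (T : Type) (g : set_type (pcover P) -> T) :=
  forall x y, prel P (zip_config (val x) (val y)) -> g x = g y.

Lemma pquot_lift_pi (T : Type) (g : set_type (pcover P) -> T) x :
  respects g -> pquot_lift g (pquot_pi x) = g x.
Proof. by move=> gP; apply/gP/pquot_piP; exact: pquot_repr_pi. Qed.

Lemma continuous_pquot_lift (Y : topologicalType) (g : set_type (pcover P) -> Y) :
  respects g -> continuous g -> continuous (pquot_lift g).
Proof.
move=> gP cg; apply/quotient_continuous.
rewrite (_ : _ \o _ = g)//; apply/funext => x; exact: pquot_lift_pi.
Qed.

Lemma pquot_shift_continuous : continuous (@pquot_shift A P).
Proof.
apply: (@continuous_pquot_lift _ (fun x => pquot_pi (cover_shift x))).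
  move=> x y xy; rewrite -!pquot_shift_pi; congr pquot_shift; exact/pquot_piP.
move=> x; apply: (@continuous_comp _ _ _ (@cover_shift A P) (@pquot_pi A P)).
  apply: continuous_set_type => {}x.
  apply: (@continuous_comp _ _ _ set_val (@Defs.shift A)).
    exact: initial_continuous.
  exact: continuous_shift.
exact: continuous_pquot_pi.
Qed.

Lemma pquot_shift_surj q : exists q', @pquot_shift A P q' = q.
Proof.
pose y := pquot_repr q.
have [[_ sY] _] := pcover_SFT P.
have [x Yx xy] : (@Defs.shift A @` pcover P) (val y) by rewrite sY; exact: set_valP.
exists (pquot_pi (SigSub (mem_set Yx))); rewrite pquot_shift_pi -[RHS]pquot_repr_pi.
by congr pquot_pi; exact: val_inj.
Qed.

Lemma pquot_shift_inj : injective (@pquot_shift A P).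
Proof.
move=> p q; rewrite -(pquot_repr_pi p) -(pquot_repr_pi q) !pquot_shift_pi.
move=> /pquot_piP /= pq; apply/pquot_piP.
have [[_ sZ] _] := prel_SFT P.
have : (@Defs.shift _ @` prel P)
    (zip_config (Defs.shift (val (pquot_repr p))) (Defs.shift (val (pquot_repr q)))).
  by rewrite sZ.
move=> [z Zz zE]; rewrite (_ : zip_config _ _ = z)//; apply/funext => i.
have := congr1 (fun s : config (A * A)%type => s (i - 1)) zE.
by rewrite /Defs.shift /zip_config subrK.
Qed.

End quotient.

(** When the relation of a presentation is the equality of countably many
    continuous functions, its quotient is the space of a system. *)
Lemma Zsystem_of_presentation (R : realType) (A : finType) (P : presentation A)
    (I : countType) (f : I -> config A -> R) :
  (forall i, continuous (f i)) -> (forall i x, 0 <= f i x <= 1) ->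
  (forall x y, pcover P x -> pcover P y ->
     (prel P (zip_config x y) <-> forall i, f i x = f i y)) ->
  exists X : Zsystem R, finitely_presented X /\ zspace X = pquot P.
Proof.
move=> cf f01 fP.
pose g i (x : set_type (pcover P)) := f i (val x).
have gP i : respects (g i) by move=> x y /fP; apply; exact: set_valP.
have cg i : continuous (pquot_lift (g i)).
  apply: continuous_pquot_lift => // x.
  apply: (@continuous_comp _ _ _ set_val (f i)); last exact: cf.
  exact: initial_continuous.
have sep p q : (forall i, pquot_lift (g i) p = pquot_lift (g i) q) -> p = q.
  rewrite -(pquot_repr_pi p) -(pquot_repr_pi q) => pq; apply/pquot_piP/fP.
  - exact: set_valP.
  - exact: set_valP.
  - by move=> i; have := pq i; rewrite !pquot_lift_pi.
have cX := @pquot_compact _ P.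
have hX := separated_hausdorff cg sep.
have mX : metrizable R (pquot P).
  by apply: separated_metrizable cX cg _ sep => i q; exact: f01.
have hs : homeomorphism (@pquot_shift A P).
  apply: compact_bijection_homeomorphism => //.
  - exact: pquot_shift_continuous.
  - exact: pquot_shift_inj.
  - exact: pquot_shift_surj.
exists (BuildZsystem cX mX hs); split=> //; exists A, P, id => //.
by exists id; split=> // x; exact: cvg_id.
Qed.

Lemma NegzS k : Negz k.+1 + 1 = Negz k.
Proof. by lia. Qed.

Lemma continuous_normalize (R : realType) (X : topologicalType) (V : finType)
    (T : V -> X -> R) (c : R) (v : V) :
  0 < c -> (forall u, continuous (T u)) ->
  continuous (fun x => T v x / Num.max c (\sum_u T u x)).
Proof.
move=> c0 cT x; apply: cvgM; first exact: cT.
apply: cvgV; first by rewrite gt_eqF// lt_max c0.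
apply: (@continuous_max _ _ (cst c) _ x); first exact: cvg_cst.
by apply: continuous_big => [|u _]; [exact: add_continuous|exact: cT].
Qed.

(** * The coding of a simplicial complex *)

Section coding.
Context (R : realType) (V : finType) (S : simplicial_complex V).

(** A letter is blank ([None]) or a triple [(F, w, B)]: a face [F], a vertex [w]
    of [F], and the set [B] of the vertices whose track carries the digit 1. *)
Definition letter : finType := option ({set V} * V * {set V})%type.

Implicit Types (a : letter) (x y : config letter).

Definition digits a : {set V} := if a is Some (_, _, B) then B else finset.set0.

(** [F] is a face, the track of [w] carries 1, and the tracks outside [F] carry
    0. *)
Definition valid a : bool :=
  if a is Some (F, w, B) then [&& F \in faces S, w \in B & B \subset F] else true.

(** Blanks occur only to the left of the triples, and [F] and [w] are constant. *)
Definition follows a a' : bool :=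
  match a, a' with
  | None, _ => true
  | Some (F, w, _), Some (F', w', _) => (F == F') && (w == w')
  | Some _, None => false
  end.

(** The cover of the presentation; the rule looks at two letters only. *)
Definition cover : set (config letter) :=
  locally_ok (fun a a' _ => valid a && follows a a').

Lemma coverP x : cover x <-> forall i, valid (x i) && follows (x i) (x (i + 1)).
Proof. by []. Qed.

(** The relation of the presentation: same blanks, and the carry rule on every
    track. *)
Definition glue : set (config (letter * letter)%type) :=
  locally_ok (fun p q r : letter * letter =>
    ((p.1 == None) == (p.2 == None)) &&
    [forall v, carry_ok (v \in digits p.1) (v \in digits q.1) (v \in digits r.1)
                        (v \in digits p.2) (v \in digits q.2) (v \in digits r.2)]).

(** The digits of the vertex [v] along [x]; blanks count as 0. *)
Definition track x (v : V) (i : int) : bool := v \in digits (x i).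

(** The value of the track of [v], read from position [i] on. *)
Definition coord x (v : V) (i : int) : R := tval R (track x v) i.

Lemma glueP x y : glue (zip_config x y) <->
  (forall i, (x i == None :> letter) = (y i == None :> letter)) /\
  (forall v i, circle_eq (coord x v i) (coord y v i)).
Proof.
split=> [xy|[eN xy] i].
  split=> [i|v]; first by have /andP[/eqP] := xy i.
  by apply: carry_ok_circle_eq => i; have /andP[_ /forallP] := xy i; exact.
apply/andP; split; first by apply/eqP; exact: eN.
by apply/forallP => v; exact: (circle_eq_carry_ok i (xy v)).
Qed.

(** Indices of the real functions that detect gluing: at each position, one for
    the blanks and two for the circle coordinate of each track. *)
Definition observable : countType := (int * option (V * bool))%type.

Definition observe (o : observable) x : R :=
  match o with
  | (i, None) => (x i == None :> letter)%:R
  | (i, Some (v, true)) => tent (coord x v i)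
  | (i, Some (v, false)) => skew (coord x v i)
  end.

Lemma coord_bounds x v i : 0 <= coord x v i <= 1.
Proof. exact: tval_bounds. Qed.

Lemma observeP x y :
  glue (zip_config x y) <-> forall o, observe o x = observe o y.
Proof.
split=> [/glueP[eN xy] [i [[v []]|]] /=|xy].
- by have [] := (circle_eqP (coord_bounds x v i) (coord_bounds y v i)).1 (xy v i).
- by have [] := (circle_eqP (coord_bounds x v i) (coord_bounds y v i)).1 (xy v i).
- by rewrite eN.
apply/glueP; split=> [i|v i].
  have /= /eqP := xy (i, None); rewrite eqr_nat.
  by case: (x i == None :> letter); case: (y i == None :> letter).
apply/circle_eqP; try exact: coord_bounds.
by split; [exact: (xy (i, Some (v, true)))|exact: (xy (i, Some (v, false)))].
Qed.

Lemma glue_equiv : equivalence_on cover (fun x y => glue (zip_config x y)).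
Proof.
split=> [x _|x y _ _ /observeP xy|x y z _ _ _ /observeP xy /observeP yz];
  apply/observeP => o //; by rewrite xy.
Qed.

Definition coding : presentation letter :=
  Presentation (locally_ok_SFT _) (locally_ok_SFT _) glue_equiv.

Lemma continuous_coord v i : continuous (fun x => coord x v i).
Proof.
move=> x; apply/(@cvgrPdist_le R R _ _ (nbhs_filter x)) => e e0.
have [N /ltW Ne] := inv_expr2_lt e0.
have := @filter_forall _ 'I_N _ _ (nbhs_filter x) (fun k => near_letter x (i + k%:Z)).
apply: filterS => y yx; apply: le_trans Ne; apply: bval_close => k kN.
by rewrite /track (yx (Ordinal kN)).
Qed.

Lemma continuous_observe o : continuous (observe o).
Proof.
case: o => i [[v []]|] /=.
- move=> x; apply: (continuous_comp (@continuous_coord v i x)).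
  exact: continuous_tent.
- move=> x; apply: (continuous_comp (@continuous_coord v i x)).
  exact: continuous_skew.
- exact: (@continuous_letter _ R i (fun a => (a == None)%:R)).
Qed.

Lemma observe_bounds o x : 0 <= observe o x <= 1.
Proof.
case: o => i [[v []]|] /=.
- have := tent_bounds (coord_bounds x v i); lra.
- exact: skew_bounds (coord_bounds x v i).
- by case: eqP => _ /=; rewrite ?ler01 ?lexx.
Qed.

(** * The configurations that start at position 0 *)

(** The triples of [x] begin at position 0. *)
Definition starts x : bool := (x (-1) == None :> letter) && (x 0 != None :> letter).

(** For [x] starting at 0: the coordinates of the point of the cube coded by [x]. *)
Definition height x v : R := coord x v 0.

(** The point of the realization coded by [x].  Written with [tent] at position
    -1, it depends only on the class of [x] and is continuous on all
    configurations; the maximum keeps the denominator positive.  When [x]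
    starts at 0, the digit at -1 is 0, [tent] is half the height, and the sum is
    at least 1/2, which gives [positionE]. *)
Definition position x : {ptws V -> R} := fun v =>
  tent (coord x v (-1)) / Num.max 4^-1 (\sum_u tent (coord x u (-1))).

Lemma continuous_starts : continuous starts.
Proof.
move=> x U nU; rewrite nbhs_filterE.
apply: filterS2 (near_letter x (-1)) (near_letter x 0) => y y1 y0.
by rewrite /preimage /= /starts y1 y0; exact: nbhs_singleton nU.
Qed.

Lemma glue_starts x y : glue (zip_config x y) -> starts x = starts y.
Proof. by move=> /glueP[eN _]; rewrite /starts !eN. Qed.

Lemma glue_position x y : glue (zip_config x y) -> position x = position y.
Proof.
move=> /observeP xy; apply/funext => v; rewrite /position.
have eT u : tent (coord x u (-1)) = tent (coord y u (-1)) := xy (-1, Some (u, true)).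
by rewrite eT; congr (_ / Num.max _ _); apply: eq_bigr.
Qed.

Lemma continuous_position : continuous position.
Proof.
have cT v : continuous (fun x => tent (coord x v (-1))) :=
  @continuous_observe (-1, Some (v, true)).
apply: continuous_ptws => v.
apply: (@continuous_normalize R _ V (fun u x => tent (coord x u (-1)))) => //.
by rewrite invr_gt0 ltr0n.
Qed.

Section start.
Variable x : config letter.
Hypotheses (xY : cover x) (x_start : starts x).

Lemma starts_before k : x (Negz k) = None.
Proof.
elim: k => [|k IH]; first by have /andP[/eqP] := x_start.
have /coverP/(_ (Negz k.+1)) := xY; rewrite NegzS IH.
by case: (x (Negz k.+1)) => [[[F w] B]|]//=; rewrite andbF.
Qed.

Lemma starts_after : exists F w, F \in faces S /\ forall k : nat, exists B : {set V},
  [/\ x k%:Z = Some (F, w, B), w \in B & B \subset F].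
Proof.
have /andP[_] := x_start; case x0 : (x 0) => [[[F w] B0]|]// _.
have /coverP/(_ 0) := xY; rewrite x0 => /andP[/and3P[FS wB BF] _].
exists F, w; split => // k; elim: k => [|k [B [xk _ _]]]; first by exists B0.
have /coverP/(_ k%:Z) := xY; rewrite xk addrC -intS => /andP[_] /=.
case xk1 : (x k.+1%:Z) => [[[F' w'] B']|]//= /andP[/eqP eF /eqP ew].
rewrite -eF -ew in xk1 *.
have /coverP/(_ k.+1%:Z) := xY; rewrite xk1 => /andP[/and3P[_ ? ?] _].
by exists B'.
Qed.

Lemma coord_before v k : coord x v (Negz k) = height x v / 2 ^+ k.+1.
Proof.
elim: k => [|k IH]; rewrite /coord tvalS.
  by rewrite {1}/track starts_before inE add0r expr1.
rewrite {1}/track starts_before inE add0r NegzS -/(coord x v (Negz k)) IH.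
by rewrite [in RHS]exprSr invfM mulrA.
Qed.

Lemma heightP : exists F w, [/\ F \in faces S, height x w = 1,
  forall v, 0 <= height x v <= 1 & forall v, v \notin F -> height x v = 0].
Proof.
have [F [w [FS xk]]] := starts_after; exists F, w; split=> //.
- by apply/bval_eq1 => k; rewrite /track add0r; have [B [-> ? _]] := xk k.
- by move=> v; exact: coord_bounds.
move=> v vF; apply/bval_eq0 => k; rewrite /track add0r; have [B [-> _ BF]] := xk k.
by apply: contra vF => /=; exact: (fintype.subsetP BF).
Qed.

Lemma sum_height_ge1 : 1 <= \sum_v height x v.
Proof.
have [F [w [_ w1 h01 _]]] := heightP; rewrite (bigD1 w)//= w1 lerDl.
by apply: sumr_ge0 => v _; have /andP[] := h01 v.
Qed.

Lemma positionE v : position x v = height x v / \sum_u height x u.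
Proof.
have tE u : tent (coord x u (-1)) = height x u / 2.
  rewrite -[-1]/(Negz 0) coord_before expr1 tent_half//.
  by have := coord_bounds x u 0; rewrite /height; lra.
have s1 := sum_height_ge1.
rewrite /position; under eq_bigr do rewrite tE.
rewrite tE -mulr_suml max_r; last lra.
by field; lra.
Qed.

Lemma position_realization : realization R S (position x).
Proof.
have [F [w [FS w1 h01 hF]]] := heightP.
have s1 := sum_height_ge1; have s0 : \sum_v height x v != 0 by lra.
split.
- move=> v; rewrite positionE divr_ge0//; last lra.
  by have /andP[] := h01 v.
- by under eq_bigr do rewrite positionE; rewrite -mulr_suml divff.
apply: (face_sub FS).
  apply/fintype.subsetP => v; rewrite inE positionE; apply: contraR => /hF ->.
  by rewrite mul0r.
apply/finset.set0Pn; exists w; rewrite inE positionE w1 mul1r invr_eq0.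
exact: s0.
Qed.

End start.

Lemma position_inj x y : cover x -> cover y -> starts x -> starts y ->
  position x = position y -> glue (zip_config x y).
Proof.
move=> xY yY sx sy pxy.
have [Fx [wx [_ hwx hx _]]] := heightP xY sx.
have [Fy [wy [_ hwy hy _]]] := heightP yY sy.
have s1x := sum_height_ge1 xY sx; have s1y := sum_height_ge1 yY sy.
set s := \sum_v height x v in s1x; set t := \sum_v height y v in s1y.
have s0 : s != 0 by rewrite gt_eqF// (lt_le_trans ltr01).
have t0 : t != 0 by rewrite gt_eqF// (lt_le_trans ltr01).
have pE v : height x v * t = height y v * s.
  have := congr1 (fun f => f v) pxy; rewrite (positionE xY sx) (positionE yY sy).
  by rewrite -/s -/t => /eqP; rewrite eqr_div// => /eqP.
(* Both families of heights have maximum 1, so the sums agree. *)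
have st : s = t.
  have := pE wx; have := pE wy; rewrite hwx hwy !mul1r => e1 e2.
  have := hx wy; have := hy wx => /andP[_ a1] /andP[_ a2].
  by apply/eqP; rewrite eq_le; move: s1x s1y e1 e2 a1 a2; clear; nra.
have hE v : height x v = height y v.
  by have := pE v; rewrite st; exact: mulIf.
apply/glueP; split.
  case=> k; last by rewrite !starts_before.
  have [F [w [_ /(_ k)[B [-> _ _]]]]] := starts_after xY sx.
  by have [F' [w' [_ /(_ k)[B' [-> _ _]]]]] := starts_after yY sy.
move=> v [k|k]; last by constructor 1; rewrite !coord_before// hE.
(* Equality modulo 1 propagates to the right by doubling. *)
elim: k => [|k]; first by constructor 1; exact: hE.
rewrite intS addrC /coord tvalS (tvalS _ (track y v)).
by apply: circle_eq_double; exact: tval_bounds.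
Qed.

Lemma position_surj (p : {ptws V -> R}) : realization R S p ->
  exists x, [/\ cover x, starts x & position x = p].
Proof.
case=> p0 p1 pS; set F := finset _ in pS.
have [w wF] : exists w, w \in F by apply/finset.set0Pn; exact: face_neq0 pS.
(* The vertex tracked by the triples is one where [p] is maximal, so that the
   rescaled point [p v / p m] has coordinate 1 there. *)
pose m := [arg max_(v > w) p v]%O.
have pm v : p v <= p m by rewrite /m; case: arg_maxP => // i _; exact.
have m0 : 0 < p m.
  by rewrite (lt_le_trans _ (pm w))// lt0r p0 andbT; move: wF; rewrite inE.
have /choice[b bE] v : exists b, bval R b = p v / p m.
  by apply: bval_surj; rewrite divr_ge0 ?(ltW m0)//= ler_pdivrMr// mul1r.
pose B k : {set V} := finset (fun v => b v k).
pose x : config letter := fun i => if i is Posz k then Some (F, m, B k) else None.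
have hE v : height x v = p v / p m.
  by rewrite -bE; apply: eq_bval => k; rewrite /track add0r /= inE.
have xY : cover x.
  move=> i; case: i => [k|k]; last by [].
  rewrite /x addrC -intS /= !eqxx pS !andbT /=; apply/andP; split.
    by rewrite inE; move: k;  apply/(bval_eq1 R (b m)); rewrite bE divff// gt_eqF.
  apply/fintype.subsetP => v; rewrite !inE; apply: contraTneq => pv0.
  by move: k; apply/(bval_eq0 R (b v)); rewrite bE pv0 mul0r.
exists x; split => //; apply/funext => v; rewrite positionE// hE.
under eq_bigr do rewrite hE.
by rewrite -mulr_suml p1 mul1r invrK divfK// gt_eqF.
Qed.

End coding.

Theorem mainTheorem15 (R : realType) (V : finType) (S : simplicial_complex V)
    (S_nonempty : faces S != finset.set0)
    (S_connected : connected (realization R S)) :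
  exists X : Zsystem R, finitely_presented X /\
    exists x : X,
      homeomorphic (set_type (connected_component [set: X] x))
                   (set_type (realization R S)).
Proof.
have [||x y _ _|X [fX XE]] := @Zsystem_of_presentation R _ (coding R S) _ (@observe R V).
- exact: continuous_observe.
- exact: observe_bounds.
- exact: observeP.
exists X; split => //; move: (zspace X) XE => _ ->.
pose P := coding R S.
pose st (x : set_type (pcover P)) := starts (val x).
pose ps (x : set_type (pcover P)) := position R (val x).
have stP : respects st by move=> x y /glue_starts; apply.
have psP : respects ps by move=> x y; exact: glue_position.
have c_st : continuous (pquot_lift st).
  apply: continuous_pquot_lift => // x.
  apply: (@continuous_comp _ _ _ set_val (@starts V)).
    exact: initial_continuous.
  exact: continuous_starts.
have c_ps : continuous (pquot_lift ps).
  apply: continuous_pquot_lift => // x.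
  apply: (@continuous_comp _ _ _ set_val (@position R V)).
    exact: initial_continuous.
  exact: continuous_position.
have Yval (x : set_type (pcover P)) : cover S (val x) := set_valP x.
pose pt z (zY : cover S z) : set_type (pcover P) := SigSub (mem_set (zY : pcover P z)).
pose C := pquot_lift st @^-1` [set true].
have [F FS] := set0Pn _ S_nonempty.
have [w wF] : exists w, w \in F by apply/finset.set0Pn; exact: face_neq0 FS.
have [|x [xY sx _]] := @position_surj R V S (fun v => (v == w)%:R).
  split=> [v||].
  - by case: eqP.
  - by rewrite (bigD1 w)//= eqxx big1 ?addr0// => v /negbTE ->.
  - rewrite (_ : finset _ = finset.set1 w); last first.
      by apply/finset.setP => v; rewrite !inE pnatr_eq0; case: (v == w).
    by apply: face_sub FS _ _; [rewrite finset.sub1set|apply/finset.set0Pn; exists w; rewrite inE].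
exists (pquot_pi (pt x xY)).
apply: (@clopen_component_homeomorphic _ _ (pquot_lift ps) C) => //.
- exact: pquot_compact.
- apply: (@hausdorff_product V (fun=> R)) => _; exact: Rhausdorff.
- by apply: preimage_clopen => //; by split; [exact: discrete_open|exact: discrete_closed].
- move=> p q; rewrite !inE -(pquot_repr_pi p) -(pquot_repr_pi q) /C /= !pquot_lift_pi//.
  move=> sp sq pq; apply/(@pquot_piP _ P).
  exact: (position_inj (Yval _) (Yval _) sp sq pq).
- apply/seteqP; split=> [_ [q qC <-]|p /position_surj[z [zY sz <-]]].
    by rewrite -(pquot_repr_pi q) pquot_lift_pi//; apply: position_realization.
  exists (pquot_pi (pt z zY)); last by rewrite pquot_lift_pi.
  by rewrite /C /= pquot_lift_pi.
- by rewrite /C /= pquot_lift_pi.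
Qed.
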